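(* Let $k\in[n]$ and $t=k/n$. For any two-block covering instance, $$\Big(\frac{1}{2-t}\Big)\cdot\mathrm{OPT}\ \le\ \mathrm{DUAL}^M_k\ \le\ \mathrm{OPT}.$$
   Context: $[n]=\{1,\dots,n\}$; $\mathbf{conv}$ denotes convex hull; $\min$ is read as infimum in the extended reals ($+\infty$ over the empty set). Two-block problem. For $i\in\{1,2\}$ let $$\mathcal{X}^{(i)}=\{(x^{(i)},y^{(i)}): A^{(i)}x^{(i)}+B^{(i)}y^{(i)}\le b^{(i)},\ y^{(i)}\ge 0 \text{ mixed-integer},\ x^{(i)}\in\{0,1\}^n\},$$ where ''mixed-integer'' means that a prescribed subset of the coordinates of $y^{(i)}$ is required to be integer, and $A^{(i)},B^{(i)},b^{(i)}$ and the objective vectors $c^{(i)},d^{(i)}$ are rational of suitable dimensions. Let $$\mathrm{OPT}=\min\Big\{\sum_{i\in\{1,2\}}\langle c^{(i)},x^{(i)}\rangle+\langle d^{(i)},y^{(i)}\rangle:\ (x^{(i)},y^{(i)})\in\mathcal{X}^{(i)},\ i\in\{1,2\},\ x^{(1)}=x^{(2)}\Big\}.$$ The instance is covering if all $c^{(i)},d^{(i)}$ are entrywise non-negative and all $A^{(i)},B^{(i)},b^{(i)}$ are entrywise non-positive. M-Lagrangian dual of level $k$. Let $\mathcal{S}=\binom{[n]}{\le k}$ be the collection of all subsets of $[n]$ of cardinality at most $k$, and $$\mathcal{X}^{(i)}_M(\mathcal{S})=\Big\{(x^{(i)},y^{(i)},w^{(i)}):(x^{(i)},y^{(i)})\in\mathcal{X}^{(i)},\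 w^{(i)}_S=\prod_{j\in S}x^{(i)}_j\ \ \forall S\in\mathcal{S}\Big\}.$$ The value of the Lagrangian dual obtained by dualizing the constraints $w^{(1)}_S=w^{(2)}_S$, $S\in\mathcal{S}$, is given by its primal characterization $$\mathrm{DUAL}^M_k=\min\Big\{\sum_{i\in\{1,2\}}\langle c^{(i)},x^{(i)}\rangle+\langle d^{(i)},y^{(i)}\rangle:\ (x^{(i)},y^{(i)},w^{(i)})\in\mathbf{conv}\{\mathcal{X}^{(i)}_M(\mathcal{S})\},\ i\in\{1,2\},\ w^{(1)}_S=w^{(2)}_S\ \forall S\in\mathcal{S}\Big\}.$$ *)

(* Defs.v *)
From HB Require Import structures.
From mathcomp Require Import all_boot all_order all_algebra.
From mathcomp Require Import boolp classical_sets reals ereal convex.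

Set Implicit Arguments.
Unset Strict Implicit.
Unset Printing Implicit Defensive.

Import Order.TTheory GRing.Theory Num.Theory.

Local Open Scope classical_set_scope.
Local Open Scope ring_scope.

Definition convex_hull (R : numDomainType) (M : lmodType R) (X : set M) :
  set M := smallest (@convex_set R M) X.

(* One block of an instance over x in {0,1}^n.  The data are rational; the
   feasible points live over a real field R, into which the data are embedded
   by ratr.  blk_int is the set of integer-constrained coordinates of y. *)
Record block (n : nat) := Block {
  blk_m : nat;
  blk_p : nat;
  blk_A : 'M[rat]_(blk_m, n);
  blk_B : 'M[rat]_(blk_m, blk_p);
  blk_b : 'cV[rat]_blk_m;
  blk_int : {set 'I_blk_p};
  blk_c : 'cV[rat]_n;
  blk_d : 'cV[rat]_blk_p
}.

Definition covering_block (n : nat) (P : block n) : Prop :=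
  [/\ (forall j, 0 <= blk_c P j 0) /\ (forall j, 0 <= blk_d P j 0),
      forall i j, blk_A P i j <= 0,
      forall i j, blk_B P i j <= 0
    & forall i, blk_b P i 0 <= 0].

Definition subsets_upto (n k : nat) := {S : {set 'I_n} | (#|S| <= k)%N}.

Section TwoBlock.
Variables (R : realType) (n : nat).

Definition dotq (p : nat) (u : 'cV[rat]_p) (v : 'cV[R]_p) : R :=
  \sum_(j < p) ratr (u j 0) * v j 0.

Definition point (P : block n) : lmodType R :=
  ('cV[R]_n * 'cV[R]_(blk_p P))%type.

Definition feasible (P : block n) : set (point P) :=
  [set z : point P | [/\ forall i, (map_mx ratr (blk_A P) *m z.1
                          + map_mx ratr (blk_B P) *m z.2) i 0
                         <= ratr (blk_b P i 0),
               forall j, 0 <= z.2 j 0,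
               forall j, j \in blk_int P -> z.2 j 0 \is a Num.int
             & forall j, z.1 j 0 = 0 \/ z.1 j 0 = 1]].

Definition cost (P : block n) (z : point P) : R :=
  dotq (blk_c P) z.1 + dotq (blk_d P) z.2.

Definition OPT (P1 P2 : block n) : \bar R :=
  ereal_inf [set e | exists (z1 : point P1) (z2 : point P2),
    [/\ feasible z1, feasible z2, z1.1 = z2.1 & e = (cost z1 + cost z2)%:E]].

(* A lifted point is ((x, y), w), with w indexed by the subsets S of
   cardinality at most k (the empty set included, where w_S = 1).  R^o is R
   viewed as a module over itself. *)
Definition lifted_point (k : nat) (P : block n) : lmodType R :=
  (point P * {ffun subsets_upto n k -> R^o})%type.

Definition feasible_M (k : nat) (P : block n) : set (lifted_point k P) :=
  [set z : lifted_point k P | feasible z.1 /\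
    forall S : subsets_upto n k, z.2 S = \prod_(j in val S) z.1.1 j 0].

Definition DUAL_M (k : nat) (P1 P2 : block n) : \bar R :=
  ereal_inf [set e | exists (z1 : lifted_point k P1) (z2 : lifted_point k P2),
    [/\ convex_hull (@feasible_M k P1) z1,
        convex_hull (@feasible_M k P2) z2,
        forall S : subsets_upto n k, z1.2 S = z2.2 S
      & e = (cost z1.1 + cost z2.1)%:E]].

End TwoBlock.

(* Main.v *)
(** Round a pair of points of the two hulls with equal [w]: viewed as
    distributions on the feasible sets, they give the same law to the trace of
    [x] on any [S] with at most [k] elements, so they can be coupled to agree
    on [S]; keep both [y]'s and take the componentwise maximum of the two [x]'s,
    which is feasible by covering.  A coordinate costs its common mean in [S]
    and at most twice that outside, and the [S] of size [k] carrying the most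
    [x]-cost carries at least a fraction [k/n] of it.
    No distribution is made explicit: the law of the trace is a linear function
    of [w] by inclusion-exclusion, and every inequality needed is linear, so it
    passes from the feasible points to their hull. *)
Require Import Defs.
From mathcomp Require Import all_boot all_order all_algebra.
From mathcomp Require Import boolp classical_sets reals ereal convex.
From mathcomp Require Import ring lra.

Set Implicit Arguments.
Unset Strict Implicit.

Import Order.TTheory GRing.Theory Num.Theory.
Local Open Scope ring_scope.

(** * Linear inequalities on convex hulls, and averaging over subsets *)

(** A half-space is convex, so it is among the sets whose intersection is the hull. *)
Lemma hull_ge (R : numDomainType) (M : lmodType R) (X : set M) (f : M -> R)
    (c : R) (z : M) :
  scalar f -> (forall u, X u -> c <= f u) -> convex_hull X z -> c <= f z.
Proof.
move=> lin_f geX hz; apply: (hz [set u | c <= f u]%classic); split=> //.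
move=> u v p; rewrite !inE /= => cu cv.
have fE a b : f (a *: u + b *: v) = a * f u + b * f v.
  have f0 : f 0 = 0 by have := lin_f (-1) 0 0; rewrite scaler0 addr0 mulN1r addNr.
  by rewrite lin_f -[b *: v]addr0 lin_f f0 addr0.
have p0 : 0 <= p%:num by [].
have p1 : 0 <= unstable.onem p%:num by rewrite subr_ge0.
rewrite fE; have := lerD (ler_wpM2l p0 cu) (ler_wpM2l p1 cv).
by rewrite -mulrDl /unstable.onem addrC subrK mul1r.
Qed.

Lemma hull_eq (R : numDomainType) (M : lmodType R) (X : set M) (f : M -> R)
    (c : R) (z : M) :
  scalar f -> (forall u, X u -> f u = c) -> convex_hull X z -> f z = c.
Proof.
move=> lin_f eqX hz; apply/le_anti/andP; split; last first.
  by apply: hull_ge hz => // u /eqX ->.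
rewrite -lerN2; apply: (@hull_ge _ _ _ (fun u => - f u)) hz.
  by move=> a u v; rewrite lin_f opprD mulrN.
by move=> u /eqX ->.
Qed.

(** Start from all of [I] and repeatedly discard an element of least weight: the average weight
    never drops. *)
Lemma exists_heavy_subset (R : realFieldType) (I : finType) (q : I -> R) (k : nat) :
  (k <= #|I|)%N ->
  exists2 S : {set I}, #|S| = k
    & k%:R * \sum_i q i <= #|I|%:R * \sum_(i in S) q i.
Proof.
move=> lekI; rewrite -[k](subKn lekI).
elim: (#|I| - k)%N (leq_subr k #|I|) => [_|m IHm ltmI].
  rewrite subn0; exists [set: I]; first by rewrite cardsT.
  by under [X in _ <= _ * X]eq_bigl do rewrite inE.
have [S cardS heavyS] := IHm (ltnW ltmI).
rewrite -(subnSK ltmI) in cardS heavyS.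
move: (#|I| - m.+1)%N cardS heavyS => p cardS heavyS.
have [i0 i0S] : exists i, i \in S by apply/set0Pn; rewrite -card_gt0 cardS.
have [i iS min_i] := @arg_minP _ R I i0 (fun i => i \in S) q i0S.
exists (S :\ i); first by move: cardS; rewrite (cardsD1 i) iS => -[].
have qi : q i * p.+1%:R <= \sum_(j in S) q j.
  by rewrite -cardS mulr_natr -sumr_const; apply: ler_sum => j; apply: min_i.
have -> : \sum_(j in S :\ i) q j = \sum_(j in S) q j - q i.
  by rewrite (big_setD1 i iS) /= addrAC subrr add0r.
have N0 : 0 <= #|I|%:R :> R by [].
have p0 : 0 <= p%:R :> R by [].
rewrite -[p.+1]addn1 natrD in qi heavyS.
have p1 : 0 < p%:R + 1 :> R by lra.
(* Averages are compared by cross-multiplication, since [p] may be [0]. *)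
rewrite -(ler_pM2l p1).
apply: (@le_trans _ _ (p%:R * (#|I|%:R * \sum_(j in S) q j))).
  by rewrite mulrCA; apply: ler_wpM2l.
have := ler_wpM2l N0 qi; lra.
Qed.

(** * The law of the trace in terms of the moments *)

Definition trace {R : realType} {n : nat} (S : {set 'I_n}) (x : 'cV[R]_n) : {set 'I_n} :=
  [set j in S | x j 0 == 1].

(* Coefficient of the monomial [\prod_(j in J) x j] in
   [\prod_(j in a) x j * \prod_(j in S :\: a) (1 - x j)]. *)
Definition atom_coef {R : realType} {n : nat} (S a J : {set 'I_n}) : R :=
  \prod_j if j \in J then (if j \in S then (-1) ^+ (j \notin a) else 0)
          else (if j \in S then (j \notin a)%:R else 1).

(** Distribute a product of two-term sums: [J] records the coordinates that contribute their [x j]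
    term. A coordinate outside [S] has the factor [0 * x j + 1]. *)
Lemma atom_coef_sum (R : realType) (n : nat) (S a : {set 'I_n}) (x : 'I_n -> R) :
  \sum_(J : {set 'I_n}) atom_coef S a J * \prod_(j in J) x j =
  \prod_(j in S) if j \in a then x j else 1 - x j.
Proof.
transitivity (\prod_j ((if j \in S then (-1) ^+ (j \notin a) else 0) * x j
                + (if j \in S then (j \notin a)%:R else 1))).
  rewrite bigA_distr; apply: eq_bigr => J _.
  rewrite /atom_coef [\prod_(j in J) _]big_mkcond -big_split /=.
  by apply: eq_bigr => j _; case: ifP; rewrite ?mulr1.
rewrite [RHS]big_mkcond; apply: eq_bigr => j _.
by case: ifP => _; case: (j \in a) => /=; ring.
Qed.

(* The mass of [trace S x = a], as a linear function of the moments [w]. *)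
Definition atom {R : realType} {n k : nat} (S a : {set 'I_n})
    (w : {ffun subsets_upto n k -> R^o}) : R :=
  \sum_(T : subsets_upto n k) atom_coef S a (val T) * w T.

Lemma atom_scalar (R : realType) (n k : nat) (S a : {set 'I_n}) :
  scalar (@atom R n k S a).
Proof.
move=> c u v; rewrite /atom mulr_sumr -big_split; apply: eq_bigr => T _.
by rewrite !ffunE mulrDr mulrCA.
Qed.

(** At a 0/1 point, the product over [S] of [x j] or [1 - x j] is the indicator of a single
    trace. *)
Lemma atom_moments (R : realType) (n k : nat) (S a : {set 'I_n}) (x : 'cV[R]_n)
    (w : {ffun subsets_upto n k -> R^o}) :
  (#|S| <= k)%N -> a \subset S -> (forall j, x j 0 = 0 \/ x j 0 = 1) ->
  (forall T : subsets_upto n k, w T = \prod_(j in val T) x j 0) ->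
  atom S a w = (a == trace S x)%:R.
Proof.
move=> leSk /fintype.subsetP sub01 x01 wE.
have -> : atom S a w = \prod_(j in S) if j \in a then x j 0 else 1 - x j 0.
  (* Monomials of degree above [k] are not contained in [S], so their coefficient vanishes and the
     moments up to level [k] suffice. *)
  rewrite -atom_coef_sum (bigID (fun J : {set 'I_n} => (#|J| <= k)%N)) /=.
  rewrite [X in _ + X]big1 ?addr0 => [|J ltkJ]; last first.
    have [|j jJ jS] := @fintype.subsetPn _ (mem J) (mem S) _.
      by apply: contra ltkJ => /subset_leq_card/leq_trans; apply.
    by rewrite /atom_coef (bigD1 j) //= jJ (negPf jS) !mul0r.
  rewrite (reindex_omap val (insub : _ -> option (subsets_upto n k))) => [|J leJk].
    apply: eq_big => [T|T _]; last by rewrite wE.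
    by rewrite (valP T) valK eqxx.
  by rewrite insubT.
have [->|] := eqVneq.
  rewrite big1 // => j jS; rewrite inE jS /=.
  by case: eqP => [//|]; case: (x01 j) => // -> _; rewrite subr0.
move=> ne; have [j jS jne] : exists2 j, j \in S & (j \in a) != (x j 0 == 1).
  apply/exists_inP; apply: contraNT ne => /exists_inPn allS.
  apply/eqP/setP=> j; rewrite inE.
  have [jS|jS] := boolP (j \in S); first by have /negPn/eqP := allS j jS.
  by apply: contraNF jS; apply: sub01.
rewrite (bigD1 j) //=; case: (x01 j) jne => -> /=.
  by rewrite [0 == 1]eq_sym oner_eq0; case: ifP; rewrite ?mul0r.
by rewrite eqxx; case: ifP; rewrite ?subrr ?mul0r.
Qed.

(** * Coupling by duality *)

(** The dual form of the coupling: bound [f1] and [f2] below by functions [V1] and [V2] of the trace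
    that add up to [M] on every cell carrying mass. Both are averaged against the same law, so the
    averages add up to [M]. *)
Lemma coupling_bound (R : realType) (n k : nat) (P1 P2 : block n)
    (S : {set 'I_n}) (f1 : Defs.point R P1 -> R) (f2 : Defs.point R P2 -> R) (M : R)
    (z1 : lifted_point R k P1) (z2 : lifted_point R k P2) :
  (#|S| <= k)%N -> scalar f1 -> scalar f2 ->
  (forall u, feasible u -> 0 <= f1 u) -> (forall u, feasible u -> 0 <= f2 u) ->
  (forall u1 u2, feasible u1 -> feasible u2 -> trace S u1.1 = trace S u2.1 ->
     M <= f1 u1 + f2 u2) ->
  convex_hull (@feasible_M R n k P1) z1 -> convex_hull (@feasible_M R n k P2) z2 ->
  (forall T, z1.2 T = z2.2 T) -> M <= f1 z1.1 + f2 z2.1.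
Proof.
move=> leSk lin1 lin2 f1_ge0 f2_ge0 leM hull1 hull2 eqw.
pose values (a : {set 'I_n}) : set R :=
  [set r | exists u, [/\ feasible u, trace S u.1 = a & r = f1 u]]%classic.
pose V1 a := inf (values a).
(* On a cell [a] with no point of [P1], [V1 a] is the junk value [inf set0] and
   [V2 a] is [0]; such cells have no mass. *)
pose V2 a := if `[< (values a !=set0)%classic >] then M - V1 a else 0.
have trace_sub (x : 'cV[R]_n) : trace S x \subset S.
  by apply/fintype.subsetP=> j; rewrite inE => /andP[].
have sum_atom (P : block n) (V : {set 'I_n} -> R) (z : lifted_point R k P) :
    feasible_M z -> \sum_(a in powerset S) V a * atom S a z.2 = V (trace S z.1.1).
  case=> -[_ _ _ x01] wE.
  rewrite (bigD1 (trace S z.1.1)) ?inE //= big1 => [|a].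
    by rewrite addr0 (atom_moments _ _ x01 wE) // eqxx mulr1.
  rewrite inE => /andP[aS /negPf ne].
  by rewrite (atom_moments _ _ x01 wE) // ne mulr0.
have lower (P : block n) (f : Defs.point R P -> R) V (z : lifted_point R k P) :
    scalar f -> (forall u, feasible u -> V (trace S u.1) <= f u) ->
    convex_hull (@feasible_M R n k P) z ->
    \sum_(a in powerset S) V a * atom S a z.2 <= f z.1.
  move=> lin_f leV hz; rewrite -subr_ge0.
  apply: (@hull_ge _ _ _ (fun z : lifted_point R k P =>
    f z.1 - \sum_(a in powerset S) V a * atom S a z.2)) hz => [c u v /=|u Fu].
    rewrite lin_f mulrBr mulr_sumr addrACA -opprD -big_split /=.
    congr (_ - _); apply: eq_bigr => a _.
    by rewrite atom_scalar mulrDr mulrCA.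
  by rewrite sum_atom // subr_ge0; apply: leV; case: Fu.
have le1 : forall u, feasible u -> V1 (trace S u.1) <= f1 u.
  move=> u Fu; apply: ge_inf; last by exists u.
  (* Non-negativity of [f1] makes [values a] bounded below, so that [inf] is a genuine lower
     bound. *)
  by exists 0 => _ [v [Fv _ ->]]; apply: f1_ge0.
have le2 : forall u, feasible u -> V2 (trace S u.1) <= f2 u.
  move=> u Fu; rewrite /V2; case: asboolP => [ne|_]; last exact: f2_ge0.
  rewrite lerBlDr -lerBlDl; apply: lb_le_inf => // _ [v [Fv tr ->]].
  by rewrite lerBlDl addrC leM.
have eq_atom a : atom S a z2.2 = atom S a z1.2.
  by apply: eq_bigr => T _; rewrite eqw.
have mass : \sum_(a in powerset S) 1 * atom S a z1.2 = 1.
  apply: (@hull_eq _ _ _ (fun z : lifted_point R k P1 =>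
    \sum_(a in powerset S) 1 * atom S a z.2)) hull1 => [c u v /=|u Fu].
    rewrite mulr_sumr -big_split; apply: eq_bigr => a _.
    by rewrite atom_scalar !mul1r.
  by rewrite (sum_atom _ (fun=> 1)).
(* Spread [M] over the cells using total mass 1, then compare cell by cell. *)
apply: le_trans (lerD (lower _ _ _ _ lin1 le1 hull1) (lower _ _ _ _ lin2 le2 hull2)).
rewrite -[leLHS]mulr1 -mass mulr_sumr -big_split /=; apply: ler_sum => a aS.
rewrite eq_atom -mulrDl /V2 mul1r; case: asboolP => [_|empty]; first by rewrite addrC subrK.
suff -> : atom S a z1.2 = 0 by rewrite !mulr0.
apply: (@hull_eq _ _ _ (fun z : lifted_point R k P1 => atom S a z.2)) hull1.
  by move=> c u v /=; rewrite atom_scalar.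
move=> u [Fu wE]; have [_ _ _ x01] := Fu; rewrite powersetE in aS.
rewrite (atom_moments _ _ x01 wE) //; case: eqP => // eqa.
by case: empty; exists (f1 u.1), u.1.
Qed.

(** * Costs and rounding in covering blocks *)

Lemma dotq_linear (R : realType) (p : nat) (c : 'cV[rat]_p) (a : R)
    (v w : 'cV[R]_p) :
  dotq c (a *: v + w) = a * dotq c v + dotq c w.
Proof.
rewrite /dotq mulr_sumr -big_split; apply: eq_bigr => j _ /=.
by rewrite !mxE mulrDr mulrCA.
Qed.

Lemma dotq_ge0 (R : realType) (p : nat) (c : 'cV[rat]_p) (v : 'cV[R]_p) :
  (forall j, 0 <= c j 0) -> (forall j, 0 <= v j 0) -> 0 <= dotq c v.
Proof. by move=> c0 v0; apply: sumr_ge0 => j _; rewrite mulr_ge0 ?ler0q. Qed.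

Lemma cost_scalar (R : realType) (n : nat) (P : block n) : scalar (@cost R n P).
Proof.
by move=> a u v; rewrite /cost !dotq_linear mulrDr addrACA.
Qed.

Lemma feasible_x_ge0 (R : realType) (n : nat) (P : block n) (u : Defs.point R P) j :
  feasible u -> 0 <= u.1 j 0.
Proof. by case=> _ _ _ /(_ j) [] ->. Qed.

Lemma feasible_dual_cost_ge0 (R : realType) (n : nat) (P : block n)
    (u : Defs.point R P) :
  covering_block P -> feasible u -> 0 <= dotq (blk_d P) u.2.
Proof. by case=> -[_ d0] _ _ _ [_ y0 _ _]; apply: dotq_ge0. Qed.

Lemma cost_ge0 (R : realType) (n : nat) (P : block n) (u : Defs.point R P) :
  covering_block P -> feasible u -> 0 <= cost u.
Proof.
move=> cov Fu; rewrite /cost addr_ge0 ?feasible_dual_cost_ge0 //.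
by case: cov => -[c0 _] _ _ _; apply: dotq_ge0 => // j; apply: feasible_x_ge0.
Qed.

(** Since [blk_A] is non-positive, raising [x] only lowers the left-hand sides; [y] is untouched, so
    its integrality survives. *)
Lemma feasible_upward (R : realType) (n : nat) (P : block n) (u : Defs.point R P)
    (x : 'cV[R]_n) :
  covering_block P -> feasible u -> (forall j, u.1 j 0 <= x j 0) ->
  (forall j, x j 0 = 0 \/ x j 0 = 1) -> feasible ((x, u.2) : Defs.point R P).
Proof.
case=> _ A_le0 _ _ [Au y0 yint x01] le_x x01'; split=> //= i.
apply: le_trans (Au i); rewrite !mxE lerD2r; apply: ler_sum => j _.
by rewrite mxE ler_wnM2l ?lerq0.
Qed.

(** Prices of the surcharge for rounding: a maximum of two vectors agreeing on [S] can exceed either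
    of them only off [S]. *)
Definition outside {n : nat} (S : {set 'I_n}) (c : 'cV[rat]_n) : 'cV[rat]_n :=
  \col_j if j \in S then 0 else c j 0.

Lemma trace_eq (R : realType) (n : nat) (S : {set 'I_n}) (v w : 'cV[R]_n) j :
  (forall j, v j 0 = 0 \/ v j 0 = 1) -> (forall j, w j 0 = 0 \/ w j 0 = 1) ->
  trace S v = trace S w -> j \in S -> v j 0 = w j 0.
Proof.
move=> v01 w01 /setP/(_ j); rewrite !inE => + jS; rewrite jS /=.
case: (v01 j) => ->; case: (w01 j) => -> //.
  by rewrite eqxx eq_sym oner_eq0.
by rewrite eqxx eq_sym oner_eq0.
Qed.

Lemma dotq_max_le (R : realType) (n : nat) (S : {set 'I_n}) (c : 'cV[rat]_n)
    (v w : 'cV[R]_n) :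
  (forall j, 0 <= c j 0) -> (forall j, 0 <= v j 0) -> (forall j, 0 <= w j 0) ->
  {in S, forall j, v j 0 = w j 0} ->
  dotq c (\col_j Num.max (v j 0) (w j 0)) <= dotq c v + dotq (outside S c) w.
Proof.
move=> c0 v0 w0 eqS; rewrite /dotq -big_split; apply: ler_sum => j _ /=.
rewrite !mxE; case: ifPn => [/eqS ->|_]; first by rewrite maxxx rmorph0 mul0r addr0.
by rewrite -mulrDr ler_wpM2l ?ler0q // ge_max lerDl lerDr v0 w0.
Qed.

(** Each block pays for the other block's [x] off [S]. The surcharge of [P2] is thus linear in [u1]
    and is grouped with [cost u1], and symmetrically, to give the separated form that
    [coupling_bound] takes. *)
Lemma OPT_le_coupled (R : realType) (n : nat) (P1 P2 : block n) (S : {set 'I_n})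
    (u1 : Defs.point R P1) (u2 : Defs.point R P2) :
  covering_block P1 -> covering_block P2 -> feasible u1 -> feasible u2 ->
  trace S u1.1 = trace S u2.1 ->
  (OPT R P1 P2 <= (cost u1 + dotq (outside S (blk_c P2)) u1.1
                   + (cost u2 + dotq (outside S (blk_c P1)) u2.1))%:E)%E.
Proof.
move=> cov1 cov2 F1 F2 tr.
have [[c1 _] _ _ _] := cov1; have [[c2 _] _ _ _] := cov2.
have [_ _ _ x1] := F1; have [_ _ _ x2] := F2.
have eqS j : j \in S -> u1.1 j 0 = u2.1 j 0 by apply: trace_eq.
pose x : 'cV[R]_n := \col_j Num.max (u1.1 j 0) (u2.1 j 0).
have x01 j : x j 0 = 0 \/ x j 0 = 1.
  rewrite mxE; case: (x1 j) => ->; case: (x2 j) => ->; rewrite ?maxxx; try by [left|right].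
  + by right; rewrite max_r.
  + by right; rewrite max_l.
have xC : x = \col_j Num.max (u2.1 j 0) (u1.1 j 0).
  by apply/colP=> j; rewrite !mxE maxC.
apply: ge_ereal_inf.
exists (cost ((x, u1.2) : Defs.point R P1) + cost ((x, u2.2) : Defs.point R P2))%:E.
  exists ((x, u1.2) : Defs.point R P1), ((x, u2.2) : Defs.point R P2); split=> //.
  - by apply: feasible_upward => // j; rewrite mxE le_max lexx.
  - by apply: feasible_upward => // j; rewrite mxE le_max lexx orbT.
rewrite lee_fin /cost /=.
have x1_ge0 j := feasible_x_ge0 j F1; have x2_ge0 j := feasible_x_ge0 j F2.
have := dotq_max_le (S := S) c1 x1_ge0 x2_ge0 eqS.
have := dotq_max_le (S := S) c2 x2_ge0 x1_ge0 (fun j jS => esym (eqS j jS)).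
rewrite -xC -/x; lra.
Qed.

(** * The approximation factor *)

(** For a singleton the moment is [x j] itself, a linear identity that persists on the hull; this is
    where [k] must be positive. *)
Lemma dual_x_eq (R : realType) (n k : nat) (P1 P2 : block n)
    (z1 : lifted_point R k P1) (z2 : lifted_point R k P2) :
  (0 < k)%N ->
  convex_hull (@feasible_M R n k P1) z1 -> convex_hull (@feasible_M R n k P2) z2 ->
  (forall T, z1.2 T = z2.2 T) -> z1.1.1 = z2.1.1.
Proof.
move=> k_gt0 hull1 hull2 eqw; apply/colP => j.
have cardj : (#|[set j]| <= k)%N by rewrite cards1.
pose T : subsets_upto n k := exist _ [set j] cardj.
have wT (P : block n) (z : lifted_point R k P) :
    convex_hull (@feasible_M R n k P) z -> z.2 T - z.1.1 j 0 = 0.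
  apply: (@hull_eq _ _ _ (fun z : lifted_point R k P => z.2 T - z.1.1 j 0)).
    move=> a u v /=; rewrite !ffunE !mxE /GRing.scale /=; ring.
  by move=> u [_ ->]; rewrite big_set1 subrr.
have /eqP := wT _ _ hull1; rewrite subr_eq0 => /eqP <-.
by have /eqP := wT _ _ hull2; rewrite subr_eq0 => /eqP <-.
Qed.

(** With [t = k / n], the surcharge is the [x]-cost off a heavy [S], at most [1 - t] times the whole
    [x]-cost. *)
Lemma OPT_le_DUAL_M (R : realType) (n k : nat) (P1 P2 : block n)
    (z1 : lifted_point R k P1) (z2 : lifted_point R k P2) :
  (1 <= k <= n)%N -> covering_block P1 -> covering_block P2 ->
  convex_hull (@feasible_M R n k P1) z1 -> convex_hull (@feasible_M R n k P2) z2 ->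
  (forall T, z1.2 T = z2.2 T) ->
  (OPT R P1 P2 <= ((2 - k%:R / n%:R) * (cost z1.1 + cost z2.1))%:E)%E.
Proof.
case/andP=> k_gt0 lekn cov1 cov2 hull1 hull2 eqw.
have n_gt0 : 0 < n%:R :> R by rewrite ltr0n (leq_trans k_gt0).
have eqx := dual_x_eq k_gt0 hull1 hull2 eqw.
pose q j : R := ratr (blk_c P1 j 0 + blk_c P2 j 0) * z1.1.1 j 0.
have [|S cardS heavyS] := @exists_heavy_subset R _ q k; first by rewrite card_ord.
rewrite card_ord in heavyS.
pose f1 (u : Defs.point R P1) := cost u + dotq (outside S (blk_c P2)) u.1.
pose f2 (u : Defs.point R P2) := cost u + dotq (outside S (blk_c P1)) u.1.
have outside_ge0 (c : 'cV[rat]_n) (v : 'cV[R]_n) : (forall j, 0 <= c j 0) -> (forall j, 0 <= v j 0) ->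
    0 <= dotq (outside S c) v.
  by move=> c0; apply: dotq_ge0 => j; rewrite mxE; case: ifP.
(* [OPT] may be infinite, so it is approached through the reals [M] below it. *)
have bound M : (M%:E <= OPT R P1 P2)%E -> M <= f1 z1.1 + f2 z2.1.
  move=> leM; apply: (coupling_bound (S := S) _ _ _ _ _ _ hull1 hull2 eqw).
  - by rewrite cardS.
  - by move=> a u v; rewrite /f1 cost_scalar dotq_linear addrACA -mulrDr.
  - by move=> a u v; rewrite /f2 cost_scalar dotq_linear addrACA -mulrDr.
  - move=> u Fu; rewrite addr_ge0 ?cost_ge0 //; apply: outside_ge0 => j.
      by case: cov2 => -[].
    exact: feasible_x_ge0.
  - move=> u Fu; rewrite addr_ge0 ?cost_ge0 //; apply: outside_ge0 => j.
      by case: cov1 => -[].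
    exact: feasible_x_ge0.
  move=> u1 u2 F1 F2 tr; rewrite -lee_fin; apply: le_trans leM _.
  exact: OPT_le_coupled.
have dual_cost_ge0 (P : block n) (z : lifted_point R k P) : covering_block P ->
    convex_hull (@feasible_M R n k P) z -> 0 <= dotq (blk_d P) z.1.2.
  move=> cov; apply: (@hull_ge _ _ _ (fun z : lifted_point R k P => dotq (blk_d P) z.1.2)).
    by move=> a u v /=; rewrite dotq_linear.
  by move=> u [Fu _]; apply: feasible_dual_cost_ge0.
have d1 := dual_cost_ge0 _ _ cov1 hull1; have d2 := dual_cost_ge0 _ _ cov2 hull2.
have sum_q : dotq (blk_c P1) z1.1.1 + dotq (blk_c P2) z1.1.1 = \sum_j q j.
  rewrite /dotq -big_split; apply: eq_bigr => j _ /=.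
  by rewrite /q rmorphD mulrDl.
have sum_out : dotq (outside S (blk_c P1)) z1.1.1 + dotq (outside S (blk_c P2)) z1.1.1
    + \sum_(j in S) q j = \sum_j q j.
  rewrite /dotq -big_split [\sum_(j in S) _]big_mkcond -big_split; apply: eq_bigr => j _ /=.
  rewrite !mxE /q; case: ifP => _; rewrite ?rmorph0 ?rmorphD /=; ring.
have tle1 : k%:R / n%:R <= 1 :> R by rewrite ler_pdivrMr // mul1r ler_nat.
have heavy : k%:R / n%:R * \sum_j q j <= \sum_(j in S) q j.
  by rewrite mulrAC ler_pdivrMr // [leRHS]mulrC.
have le_f : f1 z1.1 + f2 z2.1 <= (2 - k%:R / n%:R) * (cost z1.1 + cost z2.1).
  rewrite /f1 /f2 /cost -eqx.
  set t := k%:R / n%:R in tle1 heavy *.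
  (* The [y]-costs are paid only once; this slack lets the factor [2 - t] apply to them too. *)
  have : 0 <= (1 - t) * (dotq (blk_d P1) z1.1.2 + dotq (blk_d P2) z2.1.2).
    by rewrite mulr_ge0 ?subr_ge0 ?addr_ge0.
  have -> : dotq (blk_c P2) z1.1.1 = \sum_j q j - dotq (blk_c P1) z1.1.1 by lra.
  lra.
rewrite -lee_fin in le_f; apply: le_trans le_f.
(* If [OPT] were [+oo], [bound] would hold even for an [M] exceeding its right-hand side. *)
case: (OPT R P1 P2) bound => [r|/(_ (f1 z1.1 + f2 z2.1 + 1))|_].
- by move/(_ r (lexx _)); rewrite lee_fin.
- by move/(_ (leey _)) => absurd; exfalso; lra.
- exact: leNye.
Qed.

Unset Implicit Arguments.

Theorem theorem4 (R : realType) (n k : nat) (hk : (1 <= k <= n)%N)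
    (P1 P2 : block n) (cov1 : covering_block P1) (cov2 : covering_block P2) :
  let t : R := k%:R / n%:R in
  ((1 / (2 - t))%:E * OPT R P1 P2 <= DUAL_M R k P1 P2)%E /\
  (DUAL_M R k P1 P2 <= OPT R P1 P2)%E.
Proof.
move=> t; split; apply: le_ereal_inf_tmp => _ [z1 [z2 [F1 F2 eq12 ->]]].
  have le_opt := OPT_le_DUAL_M hk cov1 cov2 F1 F2 eq12; rewrite -/t in le_opt.
  have s_gt0 : 0 < 2 - t.
    have [k_gt0 lekn] := andP hk.
    have : t <= 1 by rewrite ler_pdivrMr ?mul1r ?ler_nat // ltr0n (leq_trans k_gt0).
    lra.
  apply: (le_trans (lee_wpmul2l _ le_opt)).
    by rewrite lee_fin divr_ge0 // ltW.
  by rewrite -EFinM mulrA div1r mulVf ?mul1r // gt_eqF.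
(* A common [x] gives equal moments, so every feasible pair lifts to a dual solution of the same
   cost. *)
pose lift (P : block n) (z : Defs.point R P) : lifted_point R k P :=
  (z, [ffun T : subsets_upto n k => \prod_(j in val T) z.1 j 0]).
have hull_lift P (z : Defs.point R P) :
    feasible z -> convex_hull (@feasible_M R n k P) (lift P z).
  move=> Fz A [_ subA]; apply: subA; split=> // T.
  by rewrite ffunE.
apply: ereal_inf_lbound; exists (lift P1 z1), (lift P2 z2); split=> //.
- exact: hull_lift.
- exact: hull_lift.
- by move=> T; rewrite !ffunE eq12.
Qed.
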